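(* Let $\ell\in(0,1]$, $\alpha\in(0,1]$, $\sigma=\sqrt{\ell}$, $\ell_\alpha=1-\alpha+\alpha\ell$, and $r_\alpha(\theta)=|1-\alpha+\alpha\sigma e^{\mathrm i\theta}|$. Let $R_m=c_{m,m+1}/\alpha$ with $c_{m,n}$ as defined in the context. Then for all integers $m\ge 0$, $$R_m=(1-\ell)\,\ell_\alpha^{\,m}+\frac{2\ell}{\pi}\int_0^\pi\frac{r_\alpha(\theta)^{2m}\sin^2\theta}{1-2\sigma\cos\theta+\sigma^2}\,d\theta .$$ Moreover, denoting $s_\alpha=(1-\alpha+\alpha\sigma)^2$ and $\eta=4\alpha(1-\alpha)\sigma/s_\alpha$, we also have $$R_m=(1-\ell)\,\ell_\alpha^{\,m}+\left(\frac{8\ell}{\pi}\int_0^1\frac{\sqrt{x(1-x)}\,(1-\eta x)^m}{(1-\sigma)^2+4\sigma x}\,dx\right)s_\alpha^{\,m},$$ which can be expressed, with $\xi=4\sigma/(1-\sigma)^2$ when $\ell<1$, as $$R_m=\begin{cases}(1-\ell)\,\ell_\alpha^{\,m}+\dfrac{\ell}{(1-\sigma)^2}\,F_1\!\left(\tfrac32;-m,1;3;\eta,-\xi\right)s_\alpha^{\,m}&\text{if }\ell<1,\\[2ex]{}_2F_1\!\left(\tfrac12,-m;2;4\alpha(1-\alpha)\right)&\text{if }\ell=1.\end{cases}$$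
   Context: For integers $0\le m\le n$, $$c_{m,n}=\alpha\sum_{j=0}^{n-1}\sum_{k=0}^{m}\left[\binom{m}{k}\binom{n-1-j}{k}-\binom{n}{k}\binom{m-1-j}{k}\right](\alpha^2\ell)^k(1-\alpha)^{n+m-1-j-2k},$$ with the convention $\binom{a}{k}=0$ unless $0\le k\le a$, and $0^0=1$; the inner sum is restricted to $k\le\min\{m,n-1-j\}$ (the bracket vanishes for larger $k$). When $\ell=1$ the integrals are understood as (convergent) improper integrals at the origin. ${}_2F_1$ is Gauss's hypergeometric function ${}_2F_1(a,b;c;z)=\sum_{k\ge0}\frac{(a)_k(b)_k}{(c)_k}\frac{z^k}{k!}$, with $(x)_k=\prod_{i=0}^{k-1}(x+i)$ (here a terminating sum). $F_1$ is Appell's hypergeometric function, understood (where its double series does not converge) through Euler's integral representation, for $c>a>0$: $$F_1(a;b_1,b_2;c;u,v)=\frac{\Gamma(c)}{\Gamma(a)\Gamma(c-a)}\int_0^1\frac{x^{a-1}(1-x)^{c-a-1}}{(1-ux)^{b_1}(1-vx)^{b_2}}\,dx .$$ *)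

(* Defs.v *)
From HB Require Import structures.
From mathcomp Require Import all_boot all_order all_algebra.
From mathcomp Require Import all_classical all_reals all_analysis.
From mathcomp Require Import complex.

Set Implicit Arguments.
Unset Strict Implicit.
Unset Printing Implicit Defensive.

Import Order.TTheory GRing.Theory Num.Theory.
Import numFieldNormedType.Exports.

Local Open Scope classical_set_scope.
Local Open Scope ring_scope.

(* The binomial coefficient with an integer upper index, 0 unless 0 <= k <= a
   (m - 1 - j below can be negative). *)
Definition binz (a : int) (k : nat) : nat :=
  match a with
  | Posz p => 'C(p, k)
  | Negz _ => 0%N
  end.

(* On the range of summation j <= n - 1, k <= m and k <= n - 1 - j, so none of
   the truncated subtractions in the exponent of (1 - alpha) or in the bound on
   k actually truncates. *)
Definition coefc (R : realType) (alpha ell : R) (m n : nat) : R :=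
  alpha * \sum_(j < n) \sum_(k < m.+1 | (k <= minn m (n - 1 - j))%N)
    (('C(m, k) * binz (n%:Z - 1 - j%:Z) k)%N%:R
       - ('C(n, k) * binz (m%:Z - 1 - j%:Z) k)%N%:R)
    * (alpha ^+ 2 * ell) ^+ k
    * (1 - alpha) ^+ (n + m - 1 - j - 2 * k)%N.

Definition coefR (R : realType) (alpha ell : R) (m : nat) : R :=
  coefc alpha ell m m.+1 / alpha.

(* |1 - alpha + alpha sigma e^(i theta)|, the modulus being that of R[i]. *)
Definition modr (R : realType) (alpha sigma theta : R) : R :=
  Normc.normc
    (real_complex R (1 - alpha)
     + real_complex R (alpha * sigma) * (cos theta +i* sin theta)%C).

(* The integral of f over [0, b]: proper if improper is false, and otherwise
   improper at the origin, that is, the limit as e -> 0+ of the integrals over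
   [e, b].  As the integral and the limit are total functions, convergence is
   the separate predicate origin_integrable. *)
Definition origin_integral (R : realType) (improper : bool) (b : R)
    (f : R -> R) : R :=
  if improper then
    lim ((\int[@lebesgue_measure R]_(x in `[e, b]) f x)%R @[e --> 0^'+])
  else (\int[@lebesgue_measure R]_(x in `[0, b]) f x)%R.

Definition origin_integrable (R : realType) (improper : bool) (b : R)
    (f : R -> R) : Prop :=
  if improper then
    (forall e : R, 0 < e < b ->
       (@lebesgue_measure R).-integrable `[e, b] (EFin \o f)) /\
    cvg ((\int[@lebesgue_measure R]_(x in `[e, b]) f x)%R @[e --> 0^'+])
  else (@lebesgue_measure R).-integrable `[0, b] (EFin \o f).

(* Euler's integral, meant for x > 0. *)
Definition Gamma (R : realType) (x : R) : R :=
  (\int[@lebesgue_measure R]_(t in `[0%R, +oo[) (t `^ (x - 1) * expR (- t)))%R.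

Definition poch (R : realType) (x : R) (k : nat) : R :=
  \prod_(i < k) (x + i%:R).

Definition hyp2F1 (R : realType) (a b c z : R) : R :=
  limn (series (fun k : nat =>
    poch a k * poch b k / poch c k * (z ^+ k / k`!%:R))).

Definition appellF1_term (R : realType) (a b1 b2 c u v : R) (p q : nat) : R :=
  poch a (p + q) * poch b1 p * poch b2 q / poch c (p + q)
  * (u ^+ p / p`!%:R) * (v ^+ q / q`!%:R).

Definition appellF1_cvg (R : realType) (a b1 b2 c u v : R) : Prop :=
  summable [set: nat * nat]
    (fun pq => (appellF1_term a b1 b2 c u v pq.1 pq.2)%:E).

Definition appellF1_series (R : realType) (a b1 b2 c u v : R) : R :=
  limn (series (fun p : nat =>
    limn (series (fun q : nat => appellF1_term a b1 b2 c u v p q)))).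

Definition appellF1_euler (R : realType) (a b1 b2 c u v : R) : R :=
  Gamma c / (Gamma a * Gamma (c - a)) *
  (\int[@lebesgue_measure R]_(x in `[0%R, 1%R])
     (x `^ (a - 1) * (1 - x) `^ (c - a - 1)
      / ((1 - u * x) `^ b1 * (1 - v * x) `^ b2)))%R.

(* Appell's F1, for c > a > 0: the sum of the double series where it converges
   (absolutely), Euler's integral elsewhere. *)
Definition appellF1 (R : realType) (a b1 b2 c u v : R) : R :=
  if `[< appellF1_cvg a b1 b2 c u v >] then appellF1_series a b1 b2 c u v
  else appellF1_euler a b1 b2 c u v.

(* Main.v *)
Require Import Defs.
From HB Require Import structures.
From mathcomp Require Import all_boot all_order all_algebra.
From mathcomp Require Import all_classical all_reals all_analysis.
From mathcomp Require Import ring lra zify.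
From mathcomp Require Import complex.

Set Implicit Arguments.
Unset Strict Implicit.
Unset Printing Implicit Defensive.

Import Order.TTheory GRing.Theory Num.Theory.
Import numFieldNormedType.Exports.

Local Open Scope classical_set_scope.
Local Open Scope ring_scope.

(** With [z = e^(i t)], [w = 1 - al + al sg z] and [Q = |w|^2], the number [R_m]
    is the mean over [0, pi] of the real part of
    [w^m \sum_(i <= m) conj w ^ i - w^(m+1) \sum_(i < m) conj w ^ i].
    A ring identity valid on [|z| = 1] shows that this mean satisfies
    [R_(m+1) = ella R_m - al (1 - al) (2 ell / pi) \int Q^m sin^2].
    With [D = 1 - 2 sg cos t + sg^2] one has [Q = ella - al (1 - al) D], so the
    right-hand side of the theorem satisfies the same recurrence; at [m = 0] the
    claim is [\int sin^2 / D = pi / 2].  The substitution [x = (1 - cos t) / 2]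
    gives the second integral, and the hypergeometric forms come from the moments
    [\int x^k (1 - x) dt = pi / 2 * (1/2)_k / (2)_k]. *)

(** * Calculus on segments *)

Section Calculus.
Context {R : realType}.
Implicit Types (f g F : R -> R) (a b c x : R).
Local Notation mu := (@lebesgue_measure R).

(** The geometric sums of powers of [conj w] are never put in closed form: [1 - conj w] vanishes at
    [t = 0] when [ell = 1], whereas a recurrence in [m] stays polynomial. Its homogeneous part is
    solved by the multiples of [ella^m], and the factor [1 - ell] is what [R_0 = 1] forces. The case
    [ell = 1] shapes the rest. The first integrand is then undefined at the origin and the second
    one is unbounded there, so both integrals are reduced to the integral over [[0, pi]] of a single
    continuous function built on [kern]. Since [appellF1] is defined by cases, its value is computed
    twice. Euler's integral needs [Gamma 3] and [Gamma (3 / 2)]. The double series is summed from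
    its convergence alone, by finite geometric sums with an explicit remainder, without deciding for
    which [xi] it converges. *)

Lemma cont_cst c : continuous (fun _ : R => c).
Proof. move=> x; exact: cvg_cst. Qed.

Lemma cont_id : continuous (fun x : R => x).
Proof. move=> x; exact: cvg_id. Qed.

Lemma cont_add f g : continuous f -> continuous g -> continuous (fun x => f x + g x).
Proof. by move=> cf cg x; apply: cvgD; [exact: cf|exact: cg]. Qed.

Lemma cont_opp f : continuous f -> continuous (fun x => - f x).
Proof. by move=> cf x; apply: cvgN; exact: cf. Qed.

Lemma cont_mul f g : continuous f -> continuous g -> continuous (fun x => f x * g x).
Proof. by move=> cf cg x; apply: cvgM; [exact: cf|exact: cg]. Qed.

Lemma cont_exp f n : continuous f -> continuous (fun x => f x ^+ n).
Proof.
by move=> cf; elim: n => [|n IH]; [exact: cont_cst|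
  under eq_fun do rewrite exprS; exact: cont_mul].
Qed.

Lemma cont_inv f : (forall x, f x != 0) -> continuous f -> continuous (fun x => (f x)^-1).
Proof. by move=> f0 cf x; apply: cvgV => //; exact: cf. Qed.

Lemma cont_comp f g : continuous g -> continuous f -> continuous (fun x => g (f x)).
Proof. by move=> cg cf x; apply: (continuous_comp (cf x)); exact: cg. Qed.

Lemma cont_sum n (F : 'I_n -> R -> R) : (forall i, continuous (F i)) ->
  continuous (fun x => \sum_(i < n) F i x).
Proof.
elim: n F => [|n IH] F cF.
  by under eq_fun do rewrite big_ord0; exact: cont_cst.
under eq_fun do rewrite big_ord_recr /=.
by apply: cont_add => //; apply: IH.
Qed.

Lemma cont_within (D : set R) f : continuous f -> {within D, continuous f}.
Proof. exact: continuous_subspaceT. Qed.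

Lemma within_integrable a b f : {within `[a, b], continuous f} ->
  mu.-integrable `[a, b] (EFin \o f).
Proof. by move=> cf; apply: continuous_compact_integrable => //; exact: segment_compact. Qed.

Lemma cont_integrable a b f : continuous f -> mu.-integrable `[a, b] (EFin \o f).
Proof. by move=> cf; apply: within_integrable; exact: cont_within. Qed.

Lemma intD a b f g : continuous f -> continuous g ->
  \int[mu]_(x in `[a, b]) (f x + g x) =
  \int[mu]_(x in `[a, b]) f x + \int[mu]_(x in `[a, b]) g x.
Proof. by move=> cf cg; rewrite RintegralD//; exact: cont_integrable. Qed.

Lemma intB a b f g : continuous f -> continuous g ->
  \int[mu]_(x in `[a, b]) (f x - g x) =
  \int[mu]_(x in `[a, b]) f x - \int[mu]_(x in `[a, b]) g x.
Proof. by move=> cf cg; rewrite RintegralB//; exact: cont_integrable. Qed.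

Lemma intZ a b c f : continuous f ->
  \int[mu]_(x in `[a, b]) (c * f x) = c * \int[mu]_(x in `[a, b]) f x.
Proof. by move=> cf; rewrite RintegralZl//; exact: cont_integrable. Qed.

Lemma int_sum a b n (F : 'I_n -> R -> R) : (forall i, continuous (F i)) ->
  \int[mu]_(x in `[a, b]) (\sum_(i < n) F i x) =
  \sum_(i < n) \int[mu]_(x in `[a, b]) F i x.
Proof.
elim: n F => [|n IH] F cF.
  rewrite big_ord0; under eq_Rintegral do rewrite big_ord0.
  by rewrite Rintegral_cst// mul0r.
under eq_Rintegral do rewrite big_ord_recr /=.
rewrite big_ord_recr /= intD//; last exact: cont_sum.
by rewrite IH.
Qed.

Lemma le_int a b f g : continuous f -> continuous g ->
  (forall x, a <= x <= b -> f x <= g x) ->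
  \int[mu]_(x in `[a, b]) f x <= \int[mu]_(x in `[a, b]) g x.
Proof.
move=> cf cg fg; have iF := cont_integrable a b cf.
have iG := cont_integrable a b cg.
by apply: (le_Rintegral _ iF iG) => // x /=; rewrite in_itv /=; exact: fg.
Qed.

Lemma der_cst c x : is_derive x 1 (fun _ : R => c) 0.
Proof. exact: is_derive_cst. Qed.

Lemma der_id x : is_derive x 1 (fun x : R => x) 1.
Proof. exact: is_derive_id. Qed.

Lemma der_add f g x df dg : is_derive x 1 f df -> is_derive x 1 g dg ->
  is_derive x 1 (fun x => f x + g x) (df + dg).
Proof. by move=> *; exact: is_deriveD. Qed.

Lemma der_opp f x df : is_derive x 1 f df -> is_derive x 1 (fun x => - f x) (- df).
Proof. by move=> *; exact: is_deriveN. Qed.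

Lemma der_mul f g x df dg : is_derive x 1 f df -> is_derive x 1 g dg ->
  is_derive x 1 (fun x => f x * g x) (df * g x + f x * dg).
Proof.
move=> hf hg; apply: (is_derive_eq (is_deriveM hf hg)).
by rewrite /GRing.scale /= addrC mulrC.
Qed.

Lemma der_exp f x df n : is_derive x 1 f df ->
  is_derive x 1 (fun x => f x ^+ n) (n%:R * f x ^+ n.-1 * df).
Proof.
move=> hf; elim: n => [|n IH].
  by under eq_fun do rewrite expr0; apply: (is_derive_eq (der_cst _ _)); rewrite !mul0r.
under eq_fun do rewrite exprS; apply: (is_derive_eq (der_mul hf IH)).
by case: n {IH} => [|n] /=; rewrite ?expr0 ?exprS -?natr1; ring.
Qed.

Lemma der_inv f x df : f x != 0 -> is_derive x 1 f df ->
  is_derive x 1 (fun x => (f x)^-1) (- df / f x ^+ 2).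
Proof.
move=> f0 hf; apply: (is_derive_eq (is_deriveV f0 hf)).
by rewrite /GRing.scale /=; field.
Qed.

Lemma der_comp f g x df dg : is_derive (f x) 1 g dg -> is_derive x 1 f df ->
  is_derive x 1 (fun x => g (f x)) (dg * df).
Proof. by move=> hg hf; exact: is_derive1_comp. Qed.

Lemma der_cont f (df : R -> R) : (forall x, is_derive x 1 f (df x)) -> continuous f.
Proof. by move=> hf x; apply/differentiable_continuous/derivable1_diffP. Qed.

Lemma int_FTC F f a b : a < b -> (forall x, is_derive x 1 F (f x)) ->
  continuous f -> \int[mu]_(x in `[a, b]) f x = F b - F a.
Proof.
move=> ab dF cf; rewrite /Rintegral (@continuous_FTC2 _ f F)//.
- exact: cont_within.
- have cF := der_cont dF.
  split => //.
  + by apply: cvg_at_right_filter; exact: cF.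
  + by apply: cvg_at_left_filter; exact: cF.
- by move=> x _; rewrite derive1E; exact: derive_val.
Qed.

End Calculus.

Ltac cont := repeat lazymatch goal with
  | |- continuous (fun x => x) => exact: cont_id
  | |- continuous (fun _ => ?c) => exact: cont_cst
  | |- continuous (fun x => @?f x + @?g x) => apply: cont_add
  | |- continuous (fun x => - @?f x) => apply: cont_opp
  | |- continuous (fun x => @?f x * @?g x) => apply: cont_mul
  | |- continuous (fun x => @?f x ^+ ?n) => apply: cont_exp
  | |- continuous (+%R _) => apply: cont_add
  | |- continuous -%R => apply: cont_opp
  | |- continuous ( *%R _) => apply: cont_mul
  | |- continuous _ =>
      first [exact: continuous_cos | exact: continuous_sin | assumption]
  end.

(** * The constant term of a power difference *)

(* [coefR al (sg ^+ 2) m] is the constant term in [z] of [powdiff w wb m] for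
   [w = 1 - al + al * sg * z] and [wb = 1 - al + al * sg / z]. *)
Definition powdiff (K : pzRingType) (w wb : K) (m : nat) : K :=
  w ^+ m * (\sum_(i < m.+1) wb ^+ i) - w ^+ m.+1 * (\sum_(i < m) wb ^+ i).

(* For [z = e^(i t)] the real part of the second term is a multiple of
   [|w|^(2m) sin^2 t], and the last term has mean zero. *)
Lemma powdiff_rec (K : comPzRingType) (al sg z zb : K) m :
  let w := 1 - al + al * sg * z in let wb := 1 - al + al * sg * zb in
  z * zb = 1 ->
  powdiff w wb m.+1 = (1 - al + al * sg ^+ 2) * powdiff w wb m
    - (1 - al) * sg * (zb - z) * ((w - 1) * (w * wb) ^+ m)
    - sg * (z * w ^+ m.+1 - z * w ^+ m).
Proof.
move=> w wb zzb; rewrite /powdiff 2!big_ord_recr /=.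
set S := \sum_(i < m) wb ^+ i.
have hS : wb * S = S + wb ^+ m - 1.
  rewrite -[wb ^+ m](subrK 1) subrX1 -/S; ring.
rewrite exprMn !exprS.
set a := w ^+ m; set b := wb ^+ m; rewrite -/b in hS.
have -> : wb * b = b * wb by rewrite mulrC.
have hw : w = 1 - al + al * sg * z by [].
have hwb : wb = 1 - al + al * sg * zb by [].
apply/eqP; rewrite -subr_eq0; apply/eqP.
(* The difference of the two sides is an explicit combination of the only two relations at hand: the
   geometric sum [hS], written without division by [wb - 1], and [z * zb = 1]. *)
rewrite [LHS](_ : _ = a * (w - 1) * sg * z * (wb * S - (S + b - 1))
  + (1 - z * zb) * (a * (al * sg ^+ 2) * ((w - 1) * S - b))); last first.
  by rewrite hw hwb; ring.
by rewrite hS zzb !subrr mulr0 mul0r addr0.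
Qed.

(** * Orthogonality of exponentials on the half period *)

Section Trigonometric.
Local Open Scope complex_scope.
Context {R : realType}.
Implicit Types (t c : R) (F G : R -> R[i]).
Local Notation mu := (@lebesgue_measure R).

Definition expi t : R[i] := cos t +i* sin t.
Definition expiN t : R[i] := cos t -i* sin t.

Lemma expiMexpiN t : expi t * expiN t = 1.
Proof.
apply/eqP; rewrite eq_complex /=; apply/andP; split; apply/eqP; last by ring.
by rewrite -(cos2Dsin2 t); ring.
Qed.

Lemma expiX t n : expi t ^+ n = cos (n%:R * t) +i* sin (n%:R * t).
Proof.
elim: n => [|n IH]; first by rewrite mul0r cos0 sin0.
rewrite exprS IH -natr1 mulrDl mul1r cosD sinD.
by apply/eqP; rewrite eq_complex /=; apply/andP; split; apply/eqP; ring.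
Qed.

Lemma expiNX t n : expiN t ^+ n = cos (n%:R * t) -i* sin (n%:R * t).
Proof.
elim: n => [|n IH]; first by rewrite mul0r cos0 sin0 oppr0.
rewrite exprS IH -natr1 mulrDl mul1r cosD sinD.
by apply/eqP; rewrite eq_complex /=; apply/andP; split; apply/eqP; ring.
Qed.

Lemma ReD (x y : R[i]) : complex.Re (x + y) = complex.Re x + complex.Re y.
Proof. by case: x; case: y. Qed.

Lemma ReB (x y : R[i]) : complex.Re (x - y) = complex.Re x - complex.Re y.
Proof. by case: x; case: y. Qed.

Lemma ReZ c (x : R[i]) : complex.Re (c%:C * x) = c * complex.Re x.
Proof. by case: x => a b /=; rewrite mul0r subr0. Qed.

Lemma Re_sum n (x : 'I_n -> R[i]) :
  complex.Re (\sum_(i < n) x i) = \sum_(i < n) complex.Re (x i).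
Proof. by elim/big_ind2: _ => // u v u' v' <- <-; exact: ReD. Qed.

Lemma sin_natpi n : sin (n%:R * pi) = 0 :> R.
Proof.
elim: n => [|n IH]; first by rewrite mul0r sin0.
by rewrite -natr1 mulrDl mul1r sinD IH sinpi mul0r mulr0 addr0.
Qed.

(** The integrand is [cos ((j - k) t)], whose antiderivative vanishes at both ends of the half
    period. The imaginary part need not integrate to 0 over [[0, pi]], which is why real parts are
    taken throughout. *)
Lemma int_expi j k :
  \int[mu]_(t in `[0, pi]) complex.Re (expi t ^+ j * expiN t ^+ k) =
  if j == k then pi else 0.
Proof.
under eq_Rintegral do rewrite expiX expiNX /= mulrN opprK -cosB -mulrBl.
have [->|jk] := eqVneq j k.
  under eq_Rintegral do rewrite subrr mul0r cos0.
  rewrite Rintegral_cst//= lebesgue_measure_itv /= lte_fin pi_gt0.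
  by rewrite -EFinD /= subr0 mul1r.
set d : R := j%:R - k%:R.
have d0 : d != 0 by rewrite subr_eq0 eqr_nat.
have dF t : is_derive t 1 (fun t => d^-1 * sin (d * t)) (cos (d * t)).
  apply: (is_derive_eq (der_mul (der_cst _ _)
    (der_comp (is_derive_sin _) (der_mul (der_cst _ _) (der_id _))))).
  by field.
have cf : continuous (fun t => cos (d * t)).
  by apply: (cont_comp (@continuous_cos R)); cont.
rewrite (int_FTC (pi_gt0 R) dF cf) mulr0 sin0 mulr0 subr0 /d mulrBl sinB.
by rewrite !sin_natpi mul0r mulr0 subrr mulr0.
Qed.

Lemma cont_expi j k : continuous (fun t => complex.Re (expi t ^+ j * expiN t ^+ k)).
Proof.
under eq_fun do rewrite expiX expiNX /= mulrN opprK -cosB -mulrBl.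
by apply: (cont_comp (@continuous_cos R)); cont.
Qed.

End Trigonometric.

(** * The coefficient as a mean over the half period, and its recurrence *)

Section Coefficients.
Local Open Scope complex_scope.
Context {R : realType}.
Variables al sg : R.
Implicit Types t : R.
Local Notation mu := (@lebesgue_measure R).

Lemma Re_sum2 n p (a b : nat -> R) t :
  complex.Re ((\sum_(j < n) (a j)%:C * expi t ^+ j)
              * (\sum_(k < p) (b k)%:C * expiN t ^+ k)) =
  \sum_(j < n) \sum_(k < p) a j * b k * complex.Re (expi t ^+ j * expiN t ^+ k).
Proof.
rewrite big_distrlr /= Re_sum; apply: eq_bigr => j _.
rewrite Re_sum; apply: eq_bigr => k _.
by rewrite mulrACA -rmorphM ReZ.
Qed.

Lemma cont_Re_sum2 n p (a b : nat -> R) : continuous (fun t =>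
  complex.Re ((\sum_(j < n) (a j)%:C * expi t ^+ j)
              * (\sum_(k < p) (b k)%:C * expiN t ^+ k))).
Proof.
under eq_fun do rewrite Re_sum2.
apply: cont_sum => j; apply: cont_sum => k.
by apply: cont_mul; [cont|exact: cont_expi].
Qed.

Lemma int_Re_sum2 n p (a b : nat -> R) :
  \int[mu]_(t in `[0, pi])
    complex.Re ((\sum_(j < n) (a j)%:C * expi t ^+ j)
                * (\sum_(k < p) (b k)%:C * expiN t ^+ k)) =
  pi * \sum_(j < n) \sum_(k < p) a j * b k * (val j == val k)%:R.
Proof.
under eq_Rintegral do rewrite Re_sum2.
have c1 (j : 'I_n) (k : 'I_p) : continuous (fun t =>
    a j * b k * complex.Re (expi t ^+ j * expiN t ^+ k)).
  by apply: cont_mul; [cont|exact: cont_expi].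
rewrite int_sum; last by move=> j; apply: cont_sum => k; exact: c1.
rewrite mulr_sumr; apply: eq_bigr => j _.
rewrite int_sum; last by move=> k; exact: c1.
rewrite mulr_sumr; apply: eq_bigr => k _.
rewrite intZ; last exact: cont_expi.
by rewrite int_expi /=; case: ifP => _; rewrite ?mulr1 ?mulr0 1?mulrC.
Qed.

Definition wpos t : R[i] := 1 - al%:C + al%:C * sg%:C * expi t.
Definition wneg t : R[i] := 1 - al%:C + al%:C * sg%:C * expiN t.
Definition wcoef (n j : nat) : R := 'C(n, j)%:R * (1 - al) ^+ (n - j) * (al * sg) ^+ j.

Lemma binom_wcoef (z : R[i]) n :
  (1 - al%:C + al%:C * sg%:C * z) ^+ n = \sum_(j < n.+1) (wcoef n j)%:C * z ^+ j.
Proof.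
rewrite exprDn; apply: eq_bigr => j _.
rewrite /wcoef !rmorphM !rmorphXn rmorphB rmorphM rmorph1 rmorph_nat -mulr_natr exprMn.
by ring.
Qed.

(** For [b <= a] and [b < N] this is the constant term of [wpos ^+ a * wneg ^+ b]. Terms with
    [k > b] vanish, so [N] can be the common bound [m.+1] of [coefc], and the exponent truncates
    only where the binomials are 0. *)
Definition binsum (a b N : nat) : R :=
  \sum_(k < N) ('C(a, k) * 'C(b, k))%:R * (al ^+ 2 * sg ^+ 2) ^+ k
    * (1 - al) ^+ (a + b - 2 * k).

Lemma binsum_wcoef a b N : (b <= a)%N -> (b < N)%N ->
  \sum_(j < a.+1) \sum_(k < b.+1) wcoef a j * wcoef b k * (val j == val k)%:R
  = binsum a b N.
Proof.
move=> ba bN; rewrite exchange_big /binsum /=.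
rewrite [RHS](bigID (fun k : 'I_N => (k < b.+1)%N)) /=.
rewrite [X in _ = _ + X]big1 ?addr0; last first.
  by move=> k; rewrite -leqNgt => bk; rewrite [in 'C(b, k)]bin_small// muln0 !mul0r.
rewrite -(big_ord_widen N (fun k => ('C(a, k) * 'C(b, k))%:R
  * (al ^+ 2 * sg ^+ 2) ^+ k * (1 - al) ^+ (a + b - 2 * k)))//.
apply: eq_bigr => k _.
have ka : (k < a.+1)%N by have := ltn_ord k; lia.
rewrite (bigD1 (Ordinal ka)) //= big1 ?addr0; last first.
  move=> j jk; rewrite (_ : (_ == _) = false) ?mulr0//; apply/negbTE.
  by apply: contra jk => /eqP jk; apply/eqP/val_inj.
rewrite eqxx mulr1 /wcoef.
have -> : (a + b - 2 * k = (a - k) + (b - k))%N by have := ltn_ord k; lia.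
have -> : (al ^+ 2 * sg ^+ 2) ^+ k = (al * sg) ^+ k * (al * sg) ^+ k.
  by rewrite -[RHS]exprMn mulrACA.
by rewrite natrM exprD; ring.
Qed.

Lemma int_Re_wpos_wneg a b N : (b <= a)%N -> (b < N)%N ->
  \int[mu]_(t in `[0, pi]) complex.Re (wpos t ^+ a * wneg t ^+ b) =
  pi * binsum a b N.
Proof.
move=> ba bN; under eq_Rintegral do rewrite /wpos /wneg !binom_wcoef.
by rewrite int_Re_sum2 (binsum_wcoef ba bN).
Qed.

Lemma cont_Re_wpos_wneg a b :
  continuous (fun t => complex.Re (wpos t ^+ a * wneg t ^+ b)).
Proof.
under eq_fun do rewrite /wpos /wneg !binom_wcoef.
exact: cont_Re_sum2.
Qed.

(** The coefficients of [expi t * wpos t ^+ n], a polynomial in [expi t] without constant term. *)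
Definition wshift (n j : nat) : R := if j is j'.+1 then wcoef n j' else 0.

(** The one-term second factor equals 1; it gives the product the shape that [int_Re_sum2]
    integrates. *)
Lemma Re_expi_wpos a t : complex.Re (expi t * wpos t ^+ a) =
  complex.Re ((\sum_(j < a.+2) (wshift a j)%:C * expi t ^+ j)
              * (\sum_(k < 1) 1%:C * expiN t ^+ k)).
Proof.
rewrite big_ord1 expr0 !mulr1 big_ord_recl /= mul0r add0r /wpos binom_wcoef.
rewrite mulr_sumr; congr complex.Re; apply: eq_bigr => j _ /=.
by rewrite exprS; ring.
Qed.

Lemma cont_Re_expi_wpos a : continuous (fun t => complex.Re (expi t * wpos t ^+ a)).
Proof.
under eq_fun do rewrite Re_expi_wpos.
exact: (@cont_Re_sum2 a.+2 1 (wshift a) (fun=> 1)).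
Qed.

Lemma int_Re_expi_wpos a :
  \int[mu]_(t in `[0, pi]) complex.Re (expi t * wpos t ^+ a) = 0.
Proof.
under eq_Rintegral do rewrite Re_expi_wpos.
rewrite (int_Re_sum2 _ _ (wshift a) (fun=> 1)).
rewrite big1 ?mulr0// => j _; rewrite big_ord1 /=.
by case: (val j) => [|j']; rewrite ?mul0r ?mulr0.
Qed.

Lemma Re_powdiff m t : complex.Re (powdiff (wpos t) (wneg t) m) =
  \sum_(i < m.+1) complex.Re (wpos t ^+ m * wneg t ^+ i)
  - \sum_(i < m) complex.Re (wpos t ^+ m.+1 * wneg t ^+ i).
Proof. by rewrite /powdiff ReB !mulr_sumr !Re_sum. Qed.

Lemma cont_Re_powdiff m :
  continuous (fun t => complex.Re (powdiff (wpos t) (wneg t) m)).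
Proof.
under eq_fun do rewrite Re_powdiff.
by apply: cont_add; [|apply: cont_opp]; apply: cont_sum => i; exact: cont_Re_wpos_wneg.
Qed.

Lemma int_powdiff m :
  \int[mu]_(t in `[0, pi]) complex.Re (powdiff (wpos t) (wneg t) m) =
  pi * (\sum_(i < m.+1) binsum m i m.+1 - \sum_(i < m) binsum m.+1 i m.+1).
Proof.
under eq_Rintegral do rewrite Re_powdiff.
rewrite intB; [|by apply: cont_sum => i; exact: cont_Re_wpos_wneg..].
rewrite int_sum; last by move=> i; exact: cont_Re_wpos_wneg.
rewrite int_sum; last by move=> i; exact: cont_Re_wpos_wneg.
rewrite mulrBr !mulr_sumr; congr (_ - _); apply: eq_bigr => i _.
  by apply: int_Re_wpos_wneg; have := ltn_ord i; lia.
by apply: int_Re_wpos_wneg; have := ltn_ord i; lia.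
Qed.

Lemma coefR_binsum m : al != 0 ->
  coefR al (sg ^+ 2) m =
  \sum_(i < m.+1) binsum m i m.+1 - \sum_(i < m) binsum m.+1 i m.+1.
Proof.
move=> al0; rewrite /coefR /coefc mulrAC divff// mul1r.
(* With [i = m - j] the upper indices [n - 1 - j] and [m - 1 - j] become [i] and [i - 1]. At [i = 0]
   the latter is negative and [binz] is 0, while [i.-1] would be 0; hence the explicit test. Outside
   the guard on [k] the binomials vanish anyway. *)
rewrite (reindex_inj rev_ord_inj) /=.
transitivity (\sum_(i < m.+1)
    (binsum m i m.+1 - (if (i == 0 :> nat)%N then 0 else binsum m.+1 i.-1 m.+1))).
  apply: eq_bigr => i _; have im := ltn_ord i.
  rewrite big_mkcond /= /binsum.
  have -> : (m.+1%:Z - 1 - (m.+1 - i.+1)%N%:Z = i%:Z)%R by lia.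
  have [i0|i0] := eqVneq (i : nat) 0%N.
    rewrite subr0; apply: eq_bigr => k _.
    have -> : (m%:Z - 1 - (m.+1 - i.+1)%N%:Z = Negz 0)%R by rewrite NegzE; lia.
    rewrite /= muln0 subr0.
    have -> : (m.+1 + m - 1 - (m.+1 - i.+1) - 2 * k = m + i - 2 * k)%N by lia.
    case: ifPn => // hk; rewrite [in 'C(i, k)]bin_small ?muln0 ?mul0r//.
    by have := ltn_ord k; move: hk; rewrite leq_min; lia.
  rewrite -sumrB; apply: eq_bigr => k _.
  have -> : (m%:Z - 1 - (m.+1 - i.+1)%N%:Z = i.-1%:Z)%R by lia.
  rewrite /=.
  have -> : (m.+1 + m - 1 - (m.+1 - i.+1) - 2 * k = m + i - 2 * k)%N by lia.
  have -> : (m.+1 + i.-1 = m + i)%N by lia.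
  case: ifPn => hk; first by ring.
  have ik : (i < k)%N by have := ltn_ord k; move: hk; rewrite leq_min; lia.
  have ik' : (i.-1 < k)%N by lia.
  by rewrite [in 'C(i, k)]bin_small// [in 'C(i.-1, k)]bin_small// !muln0 !mul0r subr0.
rewrite sumrB; congr (_ - _).
by rewrite big_ord_recl /= add0r.
Qed.

Definition sqmod t : R := (1 - al) ^+ 2 + al ^+ 2 * sg ^+ 2 + 2 * (1 - al) * al * sg * cos t.

Lemma mul_wpos_wneg t : wpos t * wneg t = (sqmod t)%:C.
Proof.
rewrite /wpos /wneg /sqmod.
apply/eqP; rewrite eq_complex /=; apply/andP; split; apply/eqP; last by ring.
have -> : al ^+ 2 * sg ^+ 2 = al ^+ 2 * sg ^+ 2 * (cos t ^+ 2 + sin t ^+ 2).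
  by rewrite cos2Dsin2 mulr1.
ring.
Qed.

Lemma cont_sqmod : continuous sqmod.
Proof. by rewrite /sqmod; cont. Qed.

Lemma coefR_rec m : al != 0 ->
  coefR al (sg ^+ 2) m.+1 = (1 - al + al * sg ^+ 2) * coefR al (sg ^+ 2) m
    - al * (1 - al) * (2 * sg ^+ 2 / pi
       * \int[mu]_(t in `[0, pi]) (sqmod t ^+ m * sin t ^+ 2)).
Proof.
move=> al0; have pi0 : pi != 0 :> R by rewrite gt_eqF// pi_gt0.
have E k : coefR al (sg ^+ 2) k = pi^-1 *
    \int[mu]_(t in `[0, pi]) complex.Re (powdiff (wpos t) (wneg t) k).
  by rewrite int_powdiff -coefR_binsum// mulKf.
have rec t : complex.Re (powdiff (wpos t) (wneg t) m.+1) =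
    ((1 - al + al * sg ^+ 2) * complex.Re (powdiff (wpos t) (wneg t) m)
    - (2 * al * (1 - al) * sg ^+ 2) * (sqmod t ^+ m * sin t ^+ 2))
    - (sg * complex.Re (expi t * wpos t ^+ m.+1)
       - sg * complex.Re (expi t * wpos t ^+ m)).
  rewrite [in LHS](powdiff_rec al%:C sg%:C m (expiMexpiN t)) -/(wpos t) -/(wneg t).
  rewrite mul_wpos_wneg ReB ReB.
  have -> : 1 - al%:C + al%:C * sg%:C ^+ 2 = (1 - al + al * sg ^+ 2)%:C.
    by rewrite rmorphD rmorphB rmorphM rmorphXn rmorph1.
  rewrite !ReZ; congr (_ - _ - _); last by rewrite ReB mulrBr.
  rewrite -rmorphXn -[1 - al%:C](_ : (1 - al)%:C = _); last by rewrite rmorphB rmorph1.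
  (* [expiN t - expi t] is [-2i sin t], so only the imaginary part [al * sg * sin t] of [wpos t - 1]
     reaches the real part, as [2 * al * sg * sin t ^+ 2]. *)
  rewrite -rmorphM -mulrA ReZ mulrA [X in complex.Re X]mulrC ReZ /=; ring.
rewrite !E; under eq_Rintegral do rewrite rec.
have c1 := @cont_Re_powdiff m; have c2 := cont_sqmod.
clear E; have c3 := @cont_Re_expi_wpos m; have c4 := @cont_Re_expi_wpos m.+1.
rewrite intB; [|cont..].
rewrite intB; [|cont..].
rewrite intB; [|cont..].
rewrite !intZ; [|cont..].
rewrite !int_Re_expi_wpos; move: (Rintegral _ _ _) (Rintegral _ _ _) => I J.
by move: (@pi R) pi0 => p p0; field.
Qed.

Lemma coefR0 ell : al != 0 -> coefR al ell 0 = 1.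
Proof.
move=> al0; rewrite /coefR /coefc mulrAC divff// mul1r.
by rewrite big_ord1 big_mkcond /= big_ord1 /= !bin0 muln0 mul1n subr0 !expr0 !mulr1.
Qed.

End Coefficients.

(** * Moments *)

Section HalfAngle.
Context {R : realType}.
Implicit Types t : R.
Local Notation mu := (@lebesgue_measure R).

Definition hav t : R := (1 - cos t) / 2.

Lemma cont_hav : continuous hav.
Proof. by rewrite /hav; cont. Qed.

Lemma der_hav t : is_derive t 1 hav (sin t / 2).
Proof.
apply: (is_derive_eq (der_mul (der_add (der_cst 1 t) (der_opp (is_derive_cos t)))
  (der_cst 2^-1 t))).
by field.
Qed.

Lemma sin2_hav t : sin t ^+ 2 = 4 * (hav t * (1 - hav t)).
Proof. by rewrite sin2cos2 /hav; field. Qed.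

Lemma hav0 : hav 0 = 0. Proof. by rewrite /hav cos0 subrr mul0r. Qed.

Lemma havpi : hav pi = 1. Proof. by rewrite /hav cospi; field. Qed.

Lemma hav_ge0 t : 0 <= hav t.
Proof. by rewrite /hav; have := cos_le1 t; lra. Qed.

Lemma hav_le1 t : hav t <= 1.
Proof. by rewrite /hav; have := cos_geN1 t; lra. Qed.

Lemma hav_gt0 t : 0 < t <= pi -> 0 < hav t.
Proof.
move=> /andP[t0 tpi].
have : cos t < cos 0.
  by rewrite ltr_cos ?in_itv/= ?lexx ?pi_ge0 ?(ltW t0).
by rewrite cos0 /hav; lra.
Qed.

(** With [x = hav t] one has [dt = dx / sqrt (x (1 - x))], so this is the Beta value
    [B(k + 1/2, 3/2)]. *)
Definition moment (k : nat) : R :=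
  \int[mu]_(t in `[0, pi]) (hav t ^+ k * (1 - hav t)).

Lemma cont_moment k : continuous (fun t => hav t ^+ k * (1 - hav t)).
Proof. by have ch := cont_hav; cont. Qed.

Lemma moment0 : moment 0 = pi / 2.
Proof.
have dF t : is_derive t 1 (fun t : R => (t + sin t) / 2) (hav t ^+ 0 * (1 - hav t)).
  apply: (is_derive_eq (der_mul (der_add (der_id t) (is_derive_sin t)) (der_cst 2^-1 t))).
  by rewrite /hav; field.
rewrite /moment (int_FTC (pi_gt0 R) dF (@cont_moment 0)) sin0 sinpi.
by rewrite !addr0 mul0r subr0.
Qed.

(** The function [hav t ^+ k * sin t * (1 - hav t)] vanishes at [0] and [pi], and its derivative
    combines the integrands of [moment k] and [moment k.+1] with coefficients [2k + 1] and
    [-(2k + 4)]. *)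
Lemma momentS k : moment k.+1 = (1 / 2 + k%:R) / (2 + k%:R) * moment k.
Proof.
have dF t : is_derive t 1 (fun t => hav t ^+ k * sin t * (1 - hav t))
    ((2 * k%:R + 1) * (hav t ^+ k * (1 - hav t))
     - (2 * k%:R + 4) * (hav t ^+ k.+1 * (1 - hav t))).
  apply: (is_derive_eq (der_mul (der_mul (der_exp k (der_hav t)) (is_derive_sin t))
    (der_add (der_cst 1 t) (der_opp (der_hav t))))).
  have -> : cos t = 1 - 2 * hav t by rewrite /hav; field.
  have h := sin2_hav t.
  case: k => [|k] /=.
    transitivity ((1 - 2 * hav t) * (1 - hav t) - sin t ^+ 2 / 2); first by field.
    by rewrite h; field.
  rewrite !exprS; set a := hav t ^+ k.
  transitivity (k.+1%:R * a * (1 - hav t) * (sin t ^+ 2 / 2)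
    + hav t * a * ((1 - 2 * hav t) * (1 - hav t) - sin t ^+ 2 / 2)); first by field.
  by rewrite h; field.
have c1 := @cont_moment k; have c2 := @cont_moment k.+1.
have /(int_FTC (pi_gt0 R) dF) : continuous (fun t =>
  (2 * k%:R + 1) * (hav t ^+ k * (1 - hav t))
     - (2 * k%:R + 4) * (hav t ^+ k.+1 * (1 - hav t))).
  by apply: cont_add; [|apply: cont_opp]; apply: cont_mul => //; exact: cont_cst.
rewrite sinpi sin0 !mulr0 !mul0r subrr intB; [|by apply: cont_mul => //; exact: cont_cst..].
rewrite !intZ// -!/(moment _).
move=> /eqP; rewrite subr_eq0 => /eqP h.
have k4 : 2 * k%:R + 4 != 0 :> R.
  by rewrite gt_eqF// ltr_wpDl// mulr_ge0.
apply: (mulfI k4); rewrite -h; field.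
by rewrite -natrD pnatr_eq0.
Qed.

Lemma momentE k : moment k = pi / 2 * (poch (1 / 2) k / poch 2 k).
Proof.
elim: k => [|k IH]; first by rewrite moment0 /poch !big_ord0 divr1 mulr1.
rewrite momentS IH /poch !big_ord_recr /= invfM.
set u := \prod_(i < k) _; set v := \prod_(i < k) _.
by move: (@pi R) (2 + k%:R)^-1 v^-1 => p w v'; ring.
Qed.

End HalfAngle.

(** * The first integral formula *)

Section Kernel.
Context {R : realType}.
Variable sg : R.
Hypothesis sg01 : 0 < sg <= 1.
Implicit Types t : R.
Local Notation mu := (@lebesgue_measure R).

Definition pden t : R := 1 - 2 * sg * cos t + sg ^+ 2.

Lemma pdenE t : pden t = (1 - sg) ^+ 2 + 4 * sg * hav t.
Proof. by rewrite /pden /hav; field. Qed.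

Lemma pden_gt0 t : sg < 1 -> 0 < pden t.
Proof.
move=> sg1; case/andP: sg01 => sg0 _; rewrite pdenE ltr_pwDl//.
  by rewrite exprn_gt0// subr_gt0.
by rewrite !mulr_ge0 ?hav_ge0 ?(ltW sg0).
Qed.

(* At [sg = 1] the quotient [sin^2 / pden] has a removable singularity at [0],
   where Rocq gives it the value [0] instead of [1]. *)
Definition kern t : R := if sg == 1 then (1 + cos t) / 2 else sin t ^+ 2 / pden t.

Lemma sg_lt1 : (sg == 1) = false -> sg < 1.
Proof. by case/andP: sg01 => _ h1 h; rewrite lt_neqAle h h1. Qed.

(** This product form also holds at [sg = 1], [t = 0], where both sides are 0, so the recurrence can
    be run on [kern] uniformly in [sg]. *)
Lemma kern_pden t : kern t * pden t = sin t ^+ 2.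
Proof.
rewrite /kern; have [h|/negbTE/sg_lt1 h] := eqVneq sg 1.
  by rewrite /pden h sin2cos2; field.
by rewrite divfK// gt_eqF// pden_gt0.
Qed.

Lemma cont_kern : continuous kern.
Proof.
rewrite /kern; have [_|/negbTE/sg_lt1 h] := eqVneq sg 1; first by cont.
apply: cont_mul; first by cont.
by apply: cont_inv; [move=> t; rewrite gt_eqF// pden_gt0|rewrite /pden; cont].
Qed.

(* [t + 2 * atan (sg * sin t / (1 - sg * cos t))] is an antiderivative of the
   Poisson kernel [(1 - sg^2) / pden t], since [atan _] is [- arg (1 - sg e^(i t))]. *)
Lemma der_arg t : sg < 1 -> is_derive t 1
  (fun t => atan (sg * sin t / (1 - sg * cos t))) ((sg * cos t - sg ^+ 2) / pden t).
Proof.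
move=> sg1; have D0 : pden t != 0 by rewrite gt_eqF// pden_gt0.
have u0 : 1 - sg * cos t != 0.
  rewrite subr_eq0 eq_sym lt_eqF//; case/andP: sg01 => sg0 _.
  by apply: le_lt_trans sg1; rewrite -[leRHS]mulr1 ler_pM2l// cos_le1.
have d1 := der_mul (der_mul (der_cst sg t) (is_derive_sin t))
  (@der_inv _ (fun t => 1 - sg * cos t) t _ u0
    (der_add (der_cst 1 t) (der_opp (der_mul (der_cst sg t) (is_derive_cos t))))).
have d2 := der_comp (is_derive1_atan _) d1.
apply: (is_derive_eq d2) => {d1 d2}.
have s2 := cos2Dsin2 t.
have s2' : sin t ^+ 2 = 1 - cos t ^+ 2 by rewrite sin2cos2.
have e1 : 1 + (sg * sin t / (1 - sg * cos t)) ^+ 2 = pden t / (1 - sg * cos t) ^+ 2.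
  by rewrite expr_div_n exprMn s2' /pden; field.
rewrite e1.
transitivity ((sg * cos t * (1 - sg * cos t) - sg ^+ 2 * sin t ^+ 2) / pden t).
  by field; rewrite D0 u0.
by rewrite s2'; congr (_ / _); ring.
Qed.

Lemma int_kern : \int[mu]_(t in `[0, pi]) kern t = pi / 2.
Proof.
have ck := cont_kern.
have [sg1|/negbTE sg1] := eqVneq sg 1.
  rewrite -moment0 /moment; apply: eq_Rintegral => t _.
  by rewrite /kern sg1 eqxx /hav; field.
have {}sg1' := sg_lt1 sg1; have sg0 : sg != 0 by case/andP: sg01 => h _; rewrite gt_eqF.
(* Dividing [4 sg^2 sin^2] by [pden] as polynomials in [cos t] gives the quotient
   [1 + sg^2 + 2 sg cos t] and the remainder [-(1 - sg^2)^2]. [H] integrates the quotient and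
   subtracts [1 - sg^2] times the integral of the Poisson kernel. *)
pose H (t : R) := ((1 + sg ^+ 2) * t + 2 * sg * sin t
  - (1 - sg ^+ 2) * (t + 2 * atan (sg * sin t / (1 - sg * cos t)))) / (4 * sg ^+ 2).
have dH t : is_derive t 1 H (kern t).
  apply: (is_derive_eq (der_mul (der_add (der_add (der_mul (der_cst (1 + sg ^+ 2) t) (der_id t))
      (der_mul (der_cst (2 * sg) t) (is_derive_sin t)))
    (der_opp (der_mul (der_cst (1 - sg ^+ 2) t)
      (der_add (der_id t) (der_mul (der_cst 2 t) (der_arg t sg1'))))))
    (der_cst (4 * sg ^+ 2)^-1 t))).
  have D0 : pden t != 0 by rewrite gt_eqF// pden_gt0.
  rewrite /kern sg1 sin2cos2.
  apply: (mulIf D0); rewrite divfK//.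
  transitivity (((1 + sg ^+ 2) * pden t + 2 * sg * cos t * pden t - (1 - sg ^+ 2) *
    (pden t + 2 * (sg * cos t - sg ^+ 2))) / (4 * sg ^+ 2)).
    by field; rewrite D0 sg0.
  by rewrite /pden; field.
rewrite (int_FTC (pi_gt0 R) dH ck) /H sinpi sin0 !mulr0 !mul0r atan0.
by move: (@pi R) => p; field.
Qed.

Variable al : R.
Hypothesis al0 : al != 0.

Lemma sqmod_pden t : sqmod al sg t = 1 - al + al * sg ^+ 2 - al * (1 - al) * pden t.
Proof. by rewrite /sqmod /pden; ring. Qed.

Lemma coefR_kern m : coefR al (sg ^+ 2) m =
  (1 - sg ^+ 2) * (1 - al + al * sg ^+ 2) ^+ m
  + 2 * sg ^+ 2 / pi * \int[mu]_(t in `[0, pi]) (sqmod al sg t ^+ m * kern t).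
Proof.
have pi0 : pi != 0 :> R by rewrite gt_eqF// pi_gt0.
have ck := cont_kern; have cQ := @cont_sqmod _ al sg.
elim: m => [|m IH].
  rewrite coefR0// expr0 mulr1; under eq_Rintegral do rewrite expr0 mul1r.
  by rewrite int_kern; move: (@pi R) pi0 => p p0; field.
rewrite coefR_rec// IH.
have e t : sqmod al sg t ^+ m.+1 * kern t =
   (1 - al + al * sg ^+ 2) * (sqmod al sg t ^+ m * kern t)
   - al * (1 - al) * (sqmod al sg t ^+ m * sin t ^+ 2).
  by rewrite exprS -kern_pden {1}sqmod_pden; ring.
under [in RHS]eq_Rintegral do rewrite e.
rewrite intB; [|cont..].
rewrite !intZ; [|cont..].
rewrite (exprS _ m); move: (Rintegral _ _ _) (Rintegral _ _ _) => I J.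
by move: (@pi R) pi0 => p p0; field.
Qed.

End Kernel.

(** * The substitution x = (1 - cos t) / 2 *)

Section Substitution.
Context {R : realType}.
Implicit Types (e t x : R) (f h : R -> R).
Local Notation mu := (@lebesgue_measure R).

Lemma int_tail b e f : continuous f -> 0 <= e <= b ->
  \int[mu]_(t in `[e, b]) f t =
  \int[mu]_(t in `[0, b]) f t - \int[mu]_(t in `[0, e]) f t.
Proof.
move=> cf /andP[e0 eb].
have i1 := cont_integrable e b cf.
rewrite (@Rintegral_itvB _ f (BLeft 0) (BRight b) e) ?bnd_simp//; last exact: cont_integrable.
rewrite Rintegral_itv_obnd_cbnd//.
by apply: integrableS i1 => //; apply: subset_itvr; rewrite bnd_simp.
Qed.

Lemma cvg_int_head f : continuous f -> \int[mu]_(t in `[0, e]) f t @[e --> 0] --> 0.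
Proof.
by move=> cf; exact: (parameterized_integral_cvg_left ltr01 (cont_integrable 0 1 cf)).
Qed.

Lemma hav_homo : {in `[0, pi] &, {homo @hav R : x y / x < y}}.
Proof.
move=> x y hx hy xy; rewrite /hav ltr_pM2r ?invr_gt0// ltrD2l ltrN2.
by rewrite ltr_cos.
Qed.

(** The free lower end [e] lets one change of variables serve both the proper integral, at [e = 0],
    and the truncated ones, where [h] is singular at the origin. *)
Lemma int_hav e h : 0 <= e < pi -> {within `[hav e, 1], continuous h} ->
  \int[mu]_(x in `[hav e, 1]) h x = \int[mu]_(t in `[e, pi]) (h (hav t) * (sin t / 2)).
Proof.
move=> /andP[e0 epi] ch.
have dE : (@hav R)^`()%classic = fun t => sin t / 2.
  by apply/funext => t; rewrite derive1E; have := der_hav t => ?; exact: derive_val.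
have cd : continuous (fun t : R => sin t / 2) by cont.
have := @integration_by_substitution_increasing _ (@hav R) h e pi.
rewrite havpi dE /Rintegral => ->//.
- exact: ltW.
- move=> x y; rewrite !in_itv/= => /andP[x1 x2] /andP[y1 y2].
  by apply: hav_homo; rewrite in_itv/= ?x2 ?y2 (le_trans e0).
- by apply/cvg_ex; exists (sin e / 2); apply: cvg_at_right_filter; exact: cd.
- by apply/cvg_ex; exists (sin pi / 2); apply: cvg_at_left_filter; exact: cd.
- split.
  + by move=> x _; have := der_hav x => ?; exact: ex_derive.
  + by apply: cvg_at_right_filter; exact: cont_hav.
  + by apply: cvg_at_left_filter; exact: cont_hav.
Qed.

Definition arc e : R := acos (1 - 2 * e).

Lemma hav_arc e : 0 <= e <= 1 -> hav (arc e) = e.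
Proof.
by move=> h; rewrite /hav /arc acosK ?in_itv/=; [field|apply/andP; split; lra].
Qed.

Lemma arc_itv e : 0 < e <= 1 -> 0 < arc e <= pi.
Proof.
by move=> h; rewrite /arc acos_gt0 ?acos_lepi//; apply/andP; split; lra.
Qed.

Lemma arc_lt e : 0 < e < 1 -> 0 < arc e < pi.
Proof.
by move=> h; rewrite /arc acos_gt0 ?acos_ltpi//; apply/andP; split; lra.
Qed.

(** Read through the increasing function [hav]: if [arc e] were at least [d'], then
    [e = hav (arc e)] would be at least [hav d'], a fixed positive number. *)
Lemma cvg_arc : arc e @[e --> 0^'+] --> 0.
Proof.
apply/cvgr0Pnorm_lt => d d0.
pose d' := Num.min d pi.
have d'0 : 0 < d' by rewrite lt_min d0 pi_gt0.
have d'pi : d' <= pi by rewrite ge_min lexx orbT.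
have hd : 0 < hav d' by apply: hav_gt0; rewrite d'0.
near=> e.
have e0 : 0 < e by near: e; exact: nbhs_right_gt.
have ed : e < hav d' by near: e; exact: nbhs_right_lt.
have e1 : e <= 1 by rewrite (le_trans (ltW ed))// hav_le1.
have /andP[a0 api] : 0 < arc e <= pi by apply: arc_itv; rewrite e0.
rewrite gtr0_norm//; apply: (@lt_le_trans _ _ d'); last by rewrite ge_min lexx.
rewrite ltNge; apply/negP => h.
have : hav d' <= hav (arc e).
  move: h; rewrite le_eqVlt => /predU1P[->//|h]; apply/ltW/hav_homo => //;
  by rewrite in_itv/= ltW.
by rewrite hav_arc ?e1 ?(ltW e0)// leNgt ed.
Unshelve. all: by end_near. Qed.

Section Weighted.
Variables (sg eta : R) (m : nat).
Hypothesis sg01 : 0 < sg <= 1.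

Definition wfun x : R := Num.sqrt (x * (1 - x)) * (1 - eta * x) ^+ m
  / ((1 - sg) ^+ 2 + 4 * sg * x).

Lemma wfun_cont e : (forall x, e <= x -> (1 - sg) ^+ 2 + 4 * sg * x != 0) ->
  {within `[e, 1], continuous wfun}.
Proof.
move=> d0; apply: continuous_in_subspaceT => x; rewrite inE/= in_itv/= => /andP[ex _].
apply: cvgM; last first.
  apply: cvgV; first exact: d0.
  have h : continuous (fun x => (1 - sg) ^+ 2 + 4 * sg * x) by cont.
  exact: h.
have h : continuous (fun x => Num.sqrt (x * (1 - x)) * (1 - eta * x) ^+ m).
  by apply: cont_mul; [apply: (cont_comp (@sqrt_continuous R))|]; cont.
exact: h.
Qed.

(** At [x = hav t] the square root is [sin t / 2], nonnegative on [[0, pi]], and the Jacobian is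
    another [sin t / 2]. The resulting [4^-1] turns the constant [2 ell / pi] into [8 ell / pi]. *)
Lemma wfun_hav t : 0 <= t <= pi -> pden sg t != 0 ->
  wfun (hav t) * (sin t / 2) = 4^-1 * ((1 - eta * hav t) ^+ m * kern sg t).
Proof.
move=> ht D0; rewrite /wfun -pdenE.
have -> : hav t * (1 - hav t) = (sin t / 2) ^+ 2 by rewrite expr_div_n sin2_hav; field.
rewrite sqrtr_sqr ger0_norm; last by rewrite divr_ge0// sin_ge0_pi.
have -> : kern sg t = sin t ^+ 2 / pden sg t by rewrite -(kern_pden sg01) mulfK.
by field.
Qed.

Lemma int_wfun e : 0 <= e < pi -> (forall t, e <= t <= pi -> pden sg t != 0) ->
  \int[mu]_(x in `[hav e, 1]) wfun x =
  4^-1 * \int[mu]_(t in `[e, pi]) ((1 - eta * hav t) ^+ m * kern sg t).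
Proof.
move=> he D0; case/andP: (he) => e0 epi.
have ck := cont_kern sg01; have ch := @cont_hav R.
rewrite int_hav//; last first.
  (* The denominator is nondecreasing in [x], so it suffices that it is nonzero, hence positive, at
     the left end [hav e]. *)
  apply: wfun_cont => x ex; have De := D0 e; rewrite lexx (ltW epi) pdenE in De.
  have {}De := De isT; rewrite gt_eqF//.
  have h : 0 < (1 - sg) ^+ 2 + 4 * sg * hav e.
    rewrite lt_neqAle eq_sym De/= addr_ge0 ?sqr_ge0// !mulr_ge0 ?hav_ge0//.
    by case/andP: sg01 => /ltW.
  apply: lt_le_trans h _; rewrite lerD2l ler_wpM2l// mulr_ge0//.
  by case/andP: sg01 => /ltW.
rewrite -intZ; last by cont.
apply: eq_Rintegral => t; rewrite inE/= in_itv/= => /andP[et tpi].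
by rewrite wfun_hav ?D0 ?et ?(le_trans e0).
Qed.

End Weighted.
End Substitution.

(** * Values of Gamma *)

Section GammaValues.
Context {R : realType}.
Local Notation mu := (@lebesgue_measure R).

(** One term [x^(n+1) / (n+1)!] of the exponential series already bounds the function by
    [(n+1)! / x]. *)
Lemma cvgy_exprn_expRN n : x ^+ n * expR (- x) @[x --> +oo] --> (0 : R).
Proof.
apply/cvgr0Pnorm_le => e e0.
have [c0 ce0] : 0 < (n.+1)`!%:R :> R /\ 0 < (n.+1)`!%:R / e.
  by rewrite divr_gt0// ltr0n fact_gt0.
near=> x.
have x0 : 0 < x by near: x; apply: nbhs_pinfty_gt; exact: num_real.
have xe : (n.+1)`!%:R / e <= x by near: x; apply: nbhs_pinfty_ge; exact: num_real.
rewrite ger0_norm ?mulr_ge0 ?exprn_ge0 ?expR_ge0 ?(ltW x0)//.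
rewrite expRN ler_pdivrMr ?expR_gt0//.
have := expR_ge1Dxn n (ltW x0); rewrite exprS => h.
apply: (@le_trans _ _ (e * (x * x ^+ n / (n.+1)`!%:R))); last first.
  by rewrite ler_pM2l// (le_trans _ h)// lerDr.
rewrite !mulrA -mulrA (mulrC (x ^+ n)) mulrA ler_peMl ?exprn_ge0 ?(ltW x0)//.
by rewrite ler_pdivlMr// mul1r mulrC -ler_pdivrMr.
Unshelve. all: by end_near. Qed.

Lemma cvgy_sqrt : Num.sqrt x @[x --> +oo] --> (+oo : set_system R).
Proof.
apply/cvgryPge => A; near=> x.
have x0 : `|A| ^+ 2 <= x by near: x; apply: nbhs_pinfty_ge; exact: num_real.
rewrite (le_trans (ler_norm A))// -[leLHS]ger0_norm// -sqrtr_sqr.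
by rewrite ler_wsqrtr.
Unshelve. all: by end_near. Qed.

Lemma Gamma3 : Gamma 3 = 2 :> R.
Proof.
rewrite /Gamma.
rewrite (@eq_Rintegral _ _ _ mu _ (fun t : R => t ^+ 2 * expR (- t))); last first.
  move=> t; rewrite inE/= in_itv/= andbT => t0.
  by rewrite (_ : 3 - 1 = 2%:R); [rewrite powR_mulrn|ring].
pose F (t : R) := - ((t ^+ 2 + 2 * t + 2) * expR (- t)).
have dF (t : R) : is_derive t 1 F (t ^+ 2 * expR (- t)).
  apply: (is_derive_eq (der_opp (der_mul (der_add (der_add (der_exp 2 (der_id t))
    (der_mul (der_cst 2 t) (der_id t))) (der_cst 2 t))
    (der_comp (is_derive_expR _) (der_opp (der_id t)))))).
  by rewrite /=; ring.
rewrite (@Rintegral_ge0_continuous_FTC2y _ _ F 0 0).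
- by rewrite /F oppr0 expR0; ring.
- by move=> x x0; rewrite mulr_ge0 ?expR_ge0 ?exprn_ge0.
- apply: cont_within; cont; apply: (cont_comp (@continuous_expR R)); cont.
- have -> : F = fun t => - (t ^+ 2 * expR (- t) + 2 * (t ^+ 1 * expR (- t))
      + 2 * (t ^+ 0 * expR (- t))).
    by apply/funext => t; rewrite /F; ring.
  rewrite -[X in _ --> X]oppr0; apply: cvgN.
  have -> : 0 = 0 + 2 * 0 + 2 * 0 :> R by ring.
  by do 2 (apply: cvgD; [|apply: cvgMr; exact: cvgy_exprn_expRN]);
    exact: cvgy_exprn_expRN.
- by move=> x _; exact: ex_derive.
- by apply: cvg_at_right_filter; exact: (der_cont dF).
- by move=> x _; rewrite derive1E; exact: derive_val.
Qed.

Lemma Gamma3half : Gamma (3 / 2) = Num.sqrt pi / 2 :> R.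
Proof.
rewrite /Gamma.
rewrite (@eq_Rintegral _ _ _ mu _ (fun t : R => Num.sqrt t * expR (- t))); last first.
  move=> t; rewrite inE/= in_itv/= andbT => t0.
  by rewrite (_ : 3 / 2 - 1 = 2^-1); [rewrite powR12_sqrt|field].
pose I (y : R) := \int[mu]_(t in `[0, y]) gauss_fun t.
(* Integrating by parts and substituting [t = y^2] leaves the Gaussian integral; [F] packs both
   operations into one antiderivative, differentiable for [t > 0] and continuous at 0 from the
   right. *)
pose F (t : R) := I (Num.sqrt t) - Num.sqrt t * expR (- t).
have ig b : mu.-integrable `[0, b] (EFin \o @gauss_fun R).
  by apply: cont_integrable; exact: continuous_gauss_fun.
have dI (y : R) : 0 < y -> is_derive y 1 I (gauss_fun y).
  move=> y0; have y1 : y < y + 1 by rewrite ltrDl.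
  have [d1 d2] := continuous_FTC1_closed y1 (ig (y + 1)) y0 (continuous_gauss_fun (x:=y)).
  by apply: DeriveDef => //; rewrite -derive1E.
have dF (t : R) : 0 < t -> is_derive t 1 F (Num.sqrt t * expR (- t)).
  move=> t0; have st : 0 < Num.sqrt t by rewrite sqrtr_gt0.
  apply: (is_derive_eq (der_add (der_comp (dI _ st) (is_derive1_sqrt t0))
    (der_opp (der_mul (is_derive1_sqrt t0)
      (der_comp (is_derive_expR _) (der_opp (der_id t))))))).
  by rewrite /= /gauss_fun sqr_sqrtr ?(ltW t0)//; ring.
have I0 : I 0 = 0 by rewrite /I set_itv1 Rintegral_set1.
have cs : continuous (fun t : R => Num.sqrt t * expR (- t)).
  cont; first exact: sqrt_continuous.
  by apply: (cont_comp (@continuous_expR R)); cont.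
rewrite (@Rintegral_ge0_continuous_FTC2y _ _ F 0 (Num.sqrt pi / 2)).
- by rewrite /F sqrtr0 I0; ring.
- by move=> x x0; rewrite mulr_ge0 ?expR_ge0 ?sqrtr_ge0.
- exact: cont_within.
- rewrite -[X in _ --> X]subr0; apply: cvgB.
    apply: (cvg_comp _ _ cvgy_sqrt).
    (* The limit at hand is that of the squared Gaussian integral, [pi / 4]; [I] is recovered from
       it because it is nonnegative. *)
    have -> : I = fun y => Num.sqrt (I y ^+ 2).
      apply/funext => y; rewrite sqrtr_sqr ger0_norm//.
      by apply: Rintegral_ge0 => z _; exact: gauss_fun_ge0.
    have -> : Num.sqrt pi / 2 = Num.sqrt (pi / 4) :> R.
      rewrite sqrtrM ?pi_ge0// sqrtrV// (_ : 4 = 2 ^+ 2); last by ring.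
      by rewrite sqrtr_sqr ger0_norm.
    apply: continuous_cvg; first exact: sqrt_continuous.
    exact: gauss_integral_proof.cvg_integral0_gauss_sqr.
  apply: (@squeeze_cvgr _ _ _ _ (fun=> 0) (fun x => x ^+ 1 * expR (- x))).
  + near=> x; have x1 : 1 <= x by near: x; apply: nbhs_pinfty_ge; exact: num_real.
    rewrite mulr_ge0 ?expR_ge0 ?sqrtr_ge0//= ler_wpM2r ?expR_ge0//.
    rewrite expr1 -[leRHS]ger0_norm ?(le_trans ler01 x1)// -sqrtr_sqr ler_wsqrtr//.
    by rewrite expr2 ler_peMl// (le_trans ler01 x1).
  + exact: cvg_cst.
  + exact: cvgy_exprn_expRN.
- by move=> x x0; have := dF x x0 => ?; exact: ex_derive.
- have -> : F 0 = 0 - 0 by rewrite /F sqrtr0 I0 mul0r.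
  apply: cvgB.
    have Ic := parameterized_integral_cvg_left ltr01 (ig 1).
    apply: (cvg_comp _ _ _ Ic).
    have := @sqrt_continuous R 0; rewrite /continuous_at sqrtr0.
    exact: cvg_at_right_filter.
  have := cs 0; rewrite /continuous_at /= sqrtr0 mul0r => h; exact: cvg_at_right_filter.
- by move=> x; rewrite in_itv/= andbT => /dF h; rewrite derive1E; exact: derive_val.
Unshelve. all: by end_near. Qed.
End GammaValues.

(** * Hypergeometric series *)

Section Hypergeometric.
Context {R : realType}.
Implicit Types (a x z eta xi : R) (u : nat -> R).
Local Notation mu := (@lebesgue_measure R).

Lemma lim_series_finite u n : (forall k, (n <= k)%N -> u k = 0) ->
  limn (series u) = \sum_(k < n) u k.
Proof.
move=> u0; apply/cvg_lim => //.
apply: (@cvg_near_cst _ _ _ _ _ _); near=> N.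
have nN : (n <= N)%N by near: N; exact: nbhs_infty_ge.
rewrite /series /= (big_cat_nat (leq0n n) nN)//= big_mkord.
rewrite [X in _ + X]big_nat_cond [X in _ + X]big1 ?addr0// => k.
by rewrite andbT => /andP[/u0].
Unshelve. all: by end_near. Qed.

Lemma pochN m k : poch (- m%:R) k / k`!%:R = (-1) ^+ k * 'C(m, k)%:R :> R.
Proof.
have k0 n : n`!%:R != 0 :> R by rewrite pnatr_eq0 -lt0n fact_gt0.
apply: (mulIf (k0 k)); rewrite divfK// -mulrA -natrM bin_ffact.
elim: k => [|k IH]; first by rewrite /poch big_ord0 expr0 ffactn0 mulr1.
rewrite /poch big_ord_recr /= -/(poch _ _) IH exprS ffactnSr natrM.
have [km|mk] := leqP k m; first by rewrite natrB//; ring.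
by rewrite ffact_small// !(mul0r, mulr0).
Qed.

Lemma poch1 k : poch 1 k = k`!%:R :> R.
Proof.
elim: k => [|k IH]; first by rewrite /poch big_ord0.
by rewrite /poch big_ord_recr /= -/(poch _ _) IH factS natrM mulrC -natr1 addrC.
Qed.

Lemma poch_gt0 a k : 0 < a -> 0 < poch a k.
Proof. by move=> a0; apply: prodr_gt0 => i _ /=; rewrite ltr_pwDl. Qed.

(** Splitting the first factors [1 / 2] and [2] off the two Pochhammer symbols of [moment k.+1]
    raises both parameters by one. The constant [8 / pi] is Euler's prefactor
    [Gamma 3 / Gamma (3 / 2) ^+ 2]. *)
Lemma moment_poch k : 8 / pi * moment k.+1 = poch (3 / 2) k / poch 3 k :> R.
Proof.
have pi0 : pi != 0 :> R by rewrite gt_eqF// pi_gt0.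
rewrite momentE /poch !big_ord_recl /=.
have -> : \prod_(i < k) (1 / 2 + (bump 0 i)%:R) = \prod_(i < k) (3 / 2 + i%:R) :> R.
  by apply: eq_bigr => i _; rewrite /bump /= natrD; field.
have -> : \prod_(i < k) (2 + (bump 0 i)%:R) = \prod_(i < k) (3 + i%:R) :> R.
  by apply: eq_bigr => i _; rewrite /bump /= natrD; ring.
rewrite !addr0 invfM; set v := (\prod_(i < k) _)^-1.
by move: (@pi R) pi0 (\prod_(i < k) _) v => p p0 w v; field.
Qed.

Lemma sum_binN x m : \sum_(k < m.+1) (-1) ^+ k * 'C(m, k)%:R * x ^+ k = (1 - x) ^+ m.
Proof.
rewrite exprBn; apply: eq_bigr => k _.
by rewrite expr1n mulr1 -mulr_natr; ring.
Qed.

Lemma hyp2F1_moment m z : hyp2F1 (1 / 2) (- m%:R) 2 z =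
  2 / pi * \int[mu]_(t in `[0, pi]) ((1 - z * hav t) ^+ m * (1 - hav t)).
Proof.
have pi0 : pi != 0 :> R by rewrite gt_eqF// pi_gt0.
have ch := @cont_hav R.
have E k : poch (1 / 2) k * poch (- m%:R) k / poch 2 k * (z ^+ k / k`!%:R) =
    (-1) ^+ k * 'C(m, k)%:R * z ^+ k * (2 / pi * moment k).
  have e (y : R) : 2 / pi * (pi / 2 * y) = y by move: (@pi R) pi0 => p p0; field.
  rewrite -pochN momentE e.
  by move: (poch 2 k)^-1 (k`!%:R)^-1 => c d; ring.
rewrite /hyp2F1 (lim_series_finite (n := m.+1)); last first.
  by move=> k mk; rewrite E bin_small// !(mulr0, mul0r).
under eq_bigr do rewrite E.
under eq_Rintegral do rewrite -sum_binN mulr_suml.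
rewrite int_sum; last by move=> k /=; cont.
rewrite mulr_sumr; apply: eq_bigr => k _.
rewrite mulrCA; congr (_ * _); rewrite /moment -intZ; last exact: cont_moment.
by apply: eq_Rintegral => t _; rewrite [(z * _) ^+ k]exprMn; ring.
Qed.

Lemma summable_row (f : nat * nat -> R) p :
  summable [set: nat * nat] (fun pq => (f pq)%:E) -> (fun q => f (p, q)) @ \oo --> 0.
Proof.
move=> fs; apply: norm_cvg0; apply: cvg_series_cvg_0.
have inj : set_inj [set: nat] (fun q : nat => (p, q)) by move=> x y _ _ [].
have h : summable (fun x : nat => predT x) (fun q => `|f (p, q)|%:E).
  rewrite /summable; apply: le_lt_trans fs.
  rewrite [leRHS](esumID ((fun q : nat => (p, q)) @` [set: nat]))// setTI.
  rewrite (esum_image _ _ (fun pq => `|(f pq)%:E|)%E inj).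
  apply: (@le_trans _ _ (\esum_(i in [set: nat]) `|(f (p, i))%:E|)%E).
    rewrite [X in (\esum_(i in X) _ <= _)%E](_ : _ = [set: nat]); last first.
      by apply/seteqP; split.
    by apply: le_esum => i _; rewrite /= normr_id.
  by rewrite leeDl//; apply: esum_ge0.
have h0 (i : nat) : predT i -> (0 <= `|f (p, i)|%:E)%E by rewrite lee_fin.
exact: (summable_cvg h0 h).
Qed.

(** * Summation of Appell's double series *)

Section Appell.
Variables (m : nat) (eta xi : R).
Hypothesis xi0 : 0 <= xi.

Let wt t : R := hav t * (1 - hav t).
Let den t : R := 1 + xi * hav t.

Let den_gt0 t : 0 < den t.
Proof. by rewrite ltr_pwDl// mulr_ge0 ?hav_ge0. Qed.

Let cont_den : continuous (fun t => (den t)^-1).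
Proof.
apply: cont_inv; first by move=> t; rewrite gt_eqF.
by have ch := @cont_hav R; rewrite /den; cont.
Qed.

Let cont_wt : continuous wt.
Proof. by have ch := @cont_hav R; rewrite /wt; cont. Qed.

Lemma appell_term p q : appellF1_term (3 / 2) (- m%:R) 1 3 eta (- xi) p q =
  8 / pi * ((-1) ^+ p * 'C(m, p)%:R * eta ^+ p) * (moment (p + q).+1 * (- xi) ^+ q).
Proof.
have q0 : q`!%:R != 0 :> R by rewrite pnatr_eq0 -lt0n fact_gt0.
rewrite /appellF1_term -pochN poch1.
have -> : poch (3 / 2) (p + q) = 8 / pi * moment (p + q).+1 * poch 3 (p + q) :> R.
  by rewrite moment_poch divfK// gt_eqF// poch_gt0.
have c0 : poch 3 (p + q) != 0 :> R.
  by rewrite gt_eqF// poch_gt0.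
rewrite !mulrA; move: (8 / pi) (p`!%:R^-1) => c d.
by field; rewrite c0 q0.
Qed.

(* The only consequence of absolute convergence that the summation needs: it
   says that the terms of the row [p = 0] tend to [0]. *)
Hypothesis xi_cvg : (fun q => xi ^+ q * moment q.+1) @ \oo --> (0 : R).

Let rowval p := \int[mu]_(t in `[0, pi]) (hav t ^+ p * wt t / den t).

(** A finite geometric sum under the integral sign, with its remainder kept; it asks for no upper
    bound on [xi]. *)
Lemma row_partial p N : \sum_(q < N) moment (p + q).+1 * (- xi) ^+ q =
  rowval p - \int[mu]_(t in `[0, pi]) (hav t ^+ p * wt t * (- xi * hav t) ^+ N / den t).
Proof.
have ch := @cont_hav R.
rewrite /rowval -intB; [|by cont..].
have e q : moment (p + q).+1 * (- xi) ^+ q =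
    \int[mu]_(t in `[0, pi]) (hav t ^+ p * wt t * (- xi * hav t) ^+ q).
  rewrite mulrC /moment -intZ; last exact: cont_moment.
  by apply: eq_Rintegral => t _;
    rewrite /wt [(- xi * _) ^+ q]exprMn (exprS _ (p + q)) exprD; ring.
under eq_bigr do rewrite e.
rewrite -int_sum; last by move=> i /=; cont.
apply: eq_Rintegral => t _.
have dn0 : den t != 0 by rewrite gt_eqF.
have denE : den t = 1 - (- xi * hav t) by rewrite /den; ring.
have geo : \sum_(q < N) (- xi * hav t) ^+ q = (1 - (- xi * hav t) ^+ N) / den t.
  by apply: (mulIf dn0); rewrite divfK// -[RHS]opprB subrX1 denE; ring.
by rewrite -mulr_sumr geo; ring.
Qed.

(** As [hav t ^+ p <= 1] and [den t >= 1], the remainder is at most [xi ^+ N * moment N.+1] in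
    absolute value for every [p], so the decay in the row [p = 0] controls all rows. *)
Lemma cvg_row p :
  (fun N => \sum_(q < N) moment (p + q).+1 * (- xi) ^+ q) @ \oo --> rowval p.
Proof.
have ch := @cont_hav R.
pose err N := \int[mu]_(t in `[0, pi])
  (hav t ^+ p * wt t * (- xi * hav t) ^+ N / den t).
rewrite (_ : (fun N => _) = (fun N => rowval p - err N)); last first.
  by apply/funext => N; rewrite row_partial.
suff h : err @ \oo --> (0 : R).
  by rewrite -[X in _ --> X]subr0; apply: cvgB h; exact: cvg_cst.
rewrite /err; apply: norm_cvg0; apply: (squeeze_cvgr _ (cvg_cst 0) xi_cvg).
near=> N; rewrite normr_ge0/=.
have c1 : continuous (fun t => hav t ^+ p * wt t * (- xi * hav t) ^+ N / den t) by cont.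
apply: (le_trans (le_normr_Rintegral _ (cont_integrable 0 pi c1))) => //.
rewrite /moment -intZ; last exact: cont_moment.
have c2 := @cont_moment R N.+1.
apply: le_int; [|by cont|].
  exact: (cont_comp (@norm_continuous _ R) c1).
move=> t _; have h0 := hav_ge0 t; have h1 := hav_le1 t.
have w0 : 0 <= wt t by rewrite mulr_ge0// subr_ge0.
have d1 : 1 <= den t by rewrite /den lerDl mulr_ge0.
have -> : xi ^+ N * (hav t ^+ N.+1 * (1 - hav t)) = wt t * (xi * hav t) ^+ N.
  by rewrite [(xi * _) ^+ N]exprMn exprS /wt; ring.
move: (wt t) w0 (den t) d1 (hav t) h0 h1 => w w0 d d1 h h0 h1.
have d0 : 0 < d := lt_le_trans ltr01 d1.
rewrite !normrM normfV !normrX normrM normrN.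
rewrite (ger0_norm h0) (ger0_norm w0) (ger0_norm xi0) (gtr0_norm d0) ler_pdivrMr//.
apply: (@le_trans _ _ (w * (xi * h) ^+ N)).
  by rewrite ler_wpM2r ?exprn_ge0 ?mulr_ge0// ler_piMl// exprn_ile1.
by rewrite ler_peMr ?mulr_ge0 ?exprn_ge0 ?mulr_ge0.
Unshelve. all: by end_near. Qed.

Lemma appell_series : appellF1_series (3 / 2) (- m%:R) 1 3 eta (- xi) =
  8 / pi * \int[mu]_(t in `[0, pi]) ((1 - eta * hav t) ^+ m * wt t / den t).
Proof.
have ch := @cont_hav R.
have E p : limn (series (fun q => appellF1_term (3 / 2) (- m%:R) 1 3 eta (- xi) p q)) =
    8 / pi * ((-1) ^+ p * 'C(m, p)%:R * eta ^+ p) * rowval p.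
  apply/cvg_lim => //.
  rewrite (_ : series _ = fun N => 8 / pi * ((-1) ^+ p * 'C(m, p)%:R * eta ^+ p)
      * \sum_(q < N) moment (p + q).+1 * (- xi) ^+ q); last first.
    apply/funext => N; rewrite /series /= big_mkord mulr_sumr.
    by apply: eq_bigr => q _; rewrite appell_term.
  by apply: cvgMr; exact: cvg_row.
rewrite /appellF1_series; under eq_fun do rewrite E.
rewrite (lim_series_finite (n := m.+1)); last first.
  by move=> k mk; rewrite bin_small// !(mulr0, mul0r).
under eq_Rintegral do rewrite -sum_binN !mulr_suml.
rewrite int_sum; last by move=> k /=; cont.
rewrite mulr_sumr; apply: eq_bigr => k _.
rewrite -mulrA; congr (_ * _); rewrite /rowval -intZ; last by cont.
by apply: eq_Rintegral => t _; rewrite [(eta * _) ^+ k]exprMn; ring.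
Qed.

End Appell.

End Hypergeometric.

(** * The second integral and the hypergeometric forms *)

Section Assembly.
Context {R : realType}.
Implicit Types (t x e b : R) (f h : R -> R).
Local Notation mu := (@lebesgue_measure R).

Lemma modr_sqr al sg t : modr al sg t ^+ 2 = sqmod al sg t.
Proof.
rewrite /modr /= sqr_sqrtr; last by rewrite addr_ge0 ?sqr_ge0.
have -> : sqmod al sg t = (1 - al) ^+ 2 + 2 * (1 - al) * al * sg * cos t
    + al ^+ 2 * sg ^+ 2 * (cos t ^+ 2 + sin t ^+ 2).
  by rewrite cos2Dsin2 /sqmod; ring.
by ring.
Qed.

(** In the improper case [f] may differ from [h] at the origin: the truncated integrals of [f] are
    those of [h], and the missing head over [[0, e]] tends to 0. *)
Lemma origin_ext improper b f h : 0 < b -> continuous h ->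
  (forall t, (if improper then 0 < t else 0 <= t) -> t <= b -> f t = h t) ->
  origin_integrable improper b f /\
  origin_integral improper b f = \int[mu]_(t in `[0, b]) h t.
Proof.
move=> b0 ch; case: improper => fh; last first.
  split; last by apply: eq_Rintegral => t; rewrite inE/= in_itv/= => /andP[]; exact: fh.
  apply: (eq_integrable _ _ _ _ (cont_integrable 0 b ch)) => //.
  by move=> t; rewrite inE/= in_itv/= => /andP[t0 tb]; rewrite /= fh.
have lim_h : (\int[mu]_(t in `[e, b]) f t @[e --> 0^'+]) -->
    (\int[mu]_(t in `[0, b]) h t).
  apply: (@cvg_trans _ ((\int[mu]_(t in `[0, b]) h t - \int[mu]_(t in `[0, e]) h t)
      @[e --> 0^'+])).
    apply: near_eq_cvg; near=> e.
    have e0 : 0 < e by near: e; exact: nbhs_right_gt.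
    have eb : e <= b by near: e; exact: nbhs_right_le.
    rewrite -int_tail ?(ltW e0)//; apply: eq_Rintegral => t.
    by rewrite inE/= in_itv/= => /andP[et tb]; rewrite fh// (lt_le_trans e0).
  rewrite -[X in _ `=>` nbhs X]subr0; apply: cvgB; first exact: cvg_cst.
  by apply: cvg_at_right_filter; exact: cvg_int_head.
split; last exact: cvg_lim.
split; last by apply/cvg_ex; eexists; exact: lim_h.
move=> e /andP[e0 eb]; apply: (eq_integrable _ _ _ _ (cont_integrable e b ch)) => //.
by move=> t; rewrite inE/= in_itv/= => /andP[et tb]; rewrite /= fh// (lt_le_trans e0).
Unshelve. all: by end_near. Qed.

Section Params.
Variables (al sg : R) (m : nat).
Hypothesis al01 : 0 < al <= 1.
Hypothesis sg01 : 0 < sg <= 1.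

Let s : R := (1 - al + al * sg) ^+ 2.
Let eta : R := 4 * al * (1 - al) * sg / s.
Let K : R := \int[mu]_(t in `[0, pi]) ((1 - eta * hav t) ^+ m * kern sg t).

Let s_gt0 : 0 < s.
Proof.
case/andP: al01 => al0 al1; case/andP: sg01 => sg0 sg1.
by rewrite exprn_gt0// ltr_wpDl ?subr_ge0// mulr_gt0.
Qed.

Lemma eta_itv : 0 <= eta <= 1.
Proof.
case/andP: al01 => al0 al1; case/andP: sg01 => sg0 sg1.
rewrite /eta divr_ge0 ?(ltW s_gt0)//=; last first.
  by rewrite !mulr_ge0 ?subr_ge0// ltW.
rewrite ler_pdivrMr// mul1r -subr_ge0.
have -> : s - 4 * al * (1 - al) * sg = (1 - al - al * sg) ^+ 2 by rewrite /s; ring.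
exact: sqr_ge0.
Qed.

Lemma sqmod_eta t : sqmod al sg t = s * (1 - eta * hav t).
Proof.
have s0 : s != 0 by rewrite gt_eqF.
rewrite mulrBr mulr1 mulrA /eta [s * _]mulrC divfK//.
by rewrite /s /sqmod /hav; field.
Qed.

Lemma int_sqmod : \int[mu]_(t in `[0, pi]) (sqmod al sg t ^+ m * kern sg t) = s ^+ m * K.
Proof.
have ck := cont_kern sg01; have ch := @cont_hav R.
rewrite /K -intZ; last by cont.
apply: eq_Rintegral => t _; rewrite sqmod_eta [(s * _) ^+ m]exprMn. by rewrite -mulrA.
Qed.

Lemma pden_neq0 t : (if sg == 1 then 0 < t else 0 <= t) -> t <= pi -> pden sg t != 0.
Proof.
case/andP: sg01 => sg0 _; have [->|/negbTE/(sg_lt1 sg01) h] := eqVneq sg 1 => t0 tpi.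
  by rewrite pdenE subrr expr0n add0r mulr1 gt_eqF// mulr_gt0// hav_gt0// t0.
by rewrite gt_eqF// pden_gt0.
Qed.

Lemma origin_theta : let f := fun theta : R =>
    modr al sg theta ^+ (2 * m) * sin theta ^+ 2
      / (1 - 2 * sg * cos theta + sg ^+ 2) in
  origin_integrable (sg == 1) pi f /\ origin_integral (sg == 1) pi f = s ^+ m * K.
Proof.
move=> f; rewrite -int_sqmod; apply: origin_ext; first exact: pi_gt0.
  by have ck := cont_kern sg01; have cQ := @cont_sqmod _ al sg; cont.
move=> t t0 tpi; rewrite /f exprM modr_sqr -(kern_pden sg01) mulrA.
by rewrite mulfK//; exact: pden_neq0.
Qed.

(** At [sg = 1] the integrand behaves like [1 / (4 sqrt x)] near 0 and has no continuous extension.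
    Each truncated integral is therefore moved to [[arc e, pi]], where the integrand is continuous
    up to 0, before [e] tends to 0. *)
Lemma origin_x : origin_integrable (sg == 1) 1 (wfun sg eta m) /\
  origin_integral (sg == 1) 1 (wfun sg eta m) = 4^-1 * K.
Proof.
case/andP: (sg01) => sg0 sg1'; have pi0 := pi_gt0 R.
have ck := cont_kern sg01; have ch := @cont_hav R.
have Dn := @pden_neq0.
have [sg1|sg1] := eqVneq sg 1; rewrite /origin_integrable /origin_integral; last first.
  split.
    apply: within_integrable; apply: wfun_cont => x x0; rewrite gt_eqF//.
    rewrite ltr_pwDl//; last by rewrite !mulr_ge0// ltW.
    by rewrite exprn_even_gt0//= subr_eq0 eq_sym.
  rewrite -{1}(@hav0 R) int_wfun ?lexx//.
  by move=> t /andP[t0 tpi]; apply: Dn; rewrite ?(negbTE sg1).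
have I e : 0 < e < 1 -> \int[mu]_(x in `[e, 1]) wfun sg eta m x =
    4^-1 * (K - \int[mu]_(t in `[0, arc e]) ((1 - eta * hav t) ^+ m * kern sg t)).
  move=> e01; case/andP: (arc_lt e01) => a0 api; case/andP: (e01) => e0 e1.
  rewrite -{1}(@hav_arc _ e) ?(ltW e0) ?(ltW e1)// int_wfun// ?(ltW a0)//; last first.
    by move=> t /andP[at_ tpi]; apply: Dn; rewrite // sg1 eqxx (lt_le_trans a0).
  by rewrite int_tail ?(ltW a0) ?(ltW api)//; cont.
have lim_w : (\int[mu]_(x in `[e, 1]) wfun sg eta m x @[e --> 0^'+]) --> 4^-1 * K.
  apply: (@cvg_trans _ ((4^-1 * (K - \int[mu]_(t in `[0, arc e])
      ((1 - eta * hav t) ^+ m * kern sg t))) @[e --> 0^'+])).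
    apply: near_eq_cvg; near=> e; rewrite I//; apply/andP; split; near: e.
      exact: nbhs_right_gt.
    exact: nbhs_right_lt.
  apply: cvgMr; rewrite -[X in _ --> X]subr0; apply: cvgB; first exact: cvg_cst.
  have c1 : continuous (fun t => (1 - eta * hav t) ^+ m * kern sg t) by cont.
  exact: (cvg_comp _ _ (@cvg_arc R) (cvg_int_head c1)).
split; last exact: cvg_lim.
split; last by apply/cvg_ex; eexists; exact: lim_w.
move=> e /andP[e0 e1]; apply: within_integrable; apply: wfun_cont => x ex.
by rewrite sg1 subrr expr0n add0r mulr1 gt_eqF// mulr_gt0// (lt_le_trans e0).
Unshelve. all: by end_near. Qed.

Let xi : R := 4 * sg / (1 - sg) ^+ 2.

Lemma appell_euler : sg < 1 -> appellF1_euler (3 / 2) (- m%:R) 1 3 eta (- xi) =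
  2 * (1 - sg) ^+ 2 / pi * K.
Proof.
move=> sg1; have pi0 := pi_gt0 R; have /andP[sg0 _] := sg01.
have d0 : 0 < (1 - sg) ^+ 2 by rewrite exprn_gt0// subr_gt0.
have xi0 : 0 <= xi by apply: divr_ge0; [apply: mulr_ge0 => //|]; exact: ltW.
rewrite /appellF1_euler (_ : 3 - 3 / 2 = 3 / 2); last by field.
rewrite Gamma3 Gamma3half.
have -> : Num.sqrt pi / 2 * (Num.sqrt pi / 2) = pi / 4 :> R.
  by rewrite mulrACA -expr2 sqr_sqrtr ?(ltW pi0)// -invfM -natrM.
have -> : 3 / 2 - 1 = 2^-1 :> R by field.
have [_ Ix] := origin_x; move: Ix; rewrite /origin_integral lt_eqF// => Ix.
rewrite (@eq_Rintegral _ _ _ mu _ (fun x : R => (1 - sg) ^+ 2 * wfun sg eta m x)).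
  rewrite RintegralZl//; last first.
    by have [h _] := origin_x; move: h; rewrite /origin_integrable lt_eqF.
  by rewrite Ix; move: (@pi R) pi0 K => p p0 k; field; rewrite gt_eqF.
move=> x; rewrite inE/= in_itv/= => /andP[x0 x1].
have e0 : 0 <= 1 - eta * x.
  by case/andP: eta_itv => h0 h1; rewrite subr_ge0 mulr_ile1.
have x10 : 0 <= 1 - x by rewrite subr_ge0.
(* When [eta = 1] the base [1 - eta * x] is 0 at [x = 1]. For [m > 0] its power of exponent [-m] is
   then 0 by convention, and the inverse, again 0, agrees with [(1 - eta * x) ^+ m]. *)
rewrite !powR12_sqrt// powR_invn// powRr1; last by rewrite mulNr opprK addr_ge0// mulr_ge0.
rewrite -sqrtrM// mulNr opprK.
have h : 0 < (1 - sg) ^+ 2 + 4 * sg * x.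
  by rewrite ltr_pwDl// !mulr_ge0// ltW.
have s10 : 1 - sg != 0 by rewrite subr_eq0 eq_sym lt_eqF.
have -> : 1 + xi * x = ((1 - sg) ^+ 2 + 4 * sg * x) / (1 - sg) ^+ 2.
  by rewrite /xi; field.
rewrite /wfun !invfM !invrK; move: (_^-1) => D; ring.
Qed.

(** Both branches of [appellF1] are shown to have this value; in the series branch, convergence is
    available as the branch condition. *)
Lemma appellE : sg < 1 -> appellF1 (3 / 2) (- m%:R) 1 3 eta (- xi) =
  2 * (1 - sg) ^+ 2 / pi * K.
Proof.
move=> sg1; have /andP[sg0 _] := sg01; have pi0 := pi_gt0 R.
rewrite /appellF1; case: asboolP => [fs|_]; last exact: appell_euler.
have d0 : 0 < (1 - sg) ^+ 2 by rewrite exprn_gt0// subr_gt0.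
have xi0 : 0 <= xi by apply: divr_ge0; [apply: mulr_ge0 => //|]; exact: ltW.
have ck := cont_kern sg01; have ch := @cont_hav R.
rewrite appell_series//.
  have -> : 2 * (1 - sg) ^+ 2 / pi * K = 8 / pi * ((1 - sg) ^+ 2 / 4 * K).
    by move: (@pi R) pi0 K => p p0 k; field; rewrite gt_eqF.
  congr (_ * _); rewrite /K -intZ; last by cont.
  apply: eq_Rintegral => t _.
  have s10 : 1 - sg != 0 by rewrite subr_eq0 eq_sym lt_eqF.
  have Dn : pden sg t != 0 by rewrite gt_eqF// pden_gt0.
  have -> : kern sg t = 4 * (hav t * (1 - hav t)) / pden sg t.
    by rewrite -sin2_hav -(kern_pden sg01) mulfK.
  have -> : 1 + xi * hav t = pden sg t / (1 - sg) ^+ 2.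
    by rewrite pdenE /xi; field.
  by field; rewrite Dn s10.
(* The factor [pi / 8] undoes the [8 / pi] of [appell_term], so that the row [p = 0] gives exactly
   the sequence required by [appell_series]. *)
have h : (fun q => pi / 8 * `|appellF1_term (3 / 2) (- m%:R) 1 3 eta (- xi) 0 q|)
    @ \oo --> (0 : R).
  rewrite -[X in _ --> X](mulr0 (pi / 8)); apply: cvgMr.
  by rewrite -[X in _ --> X](@normr0 _ R); apply: cvg_norm; exact: (summable_row 0 fs).
suff <- : (fun q => pi / 8 * `|appellF1_term (3 / 2) (- m%:R) 1 3 eta (- xi) 0 q|)
  = (fun q => xi ^+ q * moment q.+1) by [].
apply/funext => q; rewrite appell_term add0n bin0 !expr0 !mulr1.
have mge0 : 0 <= moment q.+1 :> R.
  apply: Rintegral_ge0 => t _; rewrite mulr_ge0 ?exprn_ge0 ?hav_ge0//.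
  by rewrite subr_ge0 hav_le1.
rewrite !normrM normrX normrN (ger0_norm mge0) (ger0_norm xi0).
rewrite normfV (gtr0_norm pi0) (ger0_norm (ler0n _ _)).
by move: (@pi R) pi0 => p p0; field; rewrite gt_eqF.
Qed.

End Params.
End Assembly.

Theorem theorem2 (R : realType) (ell alpha : R)
    (hell : 0 < ell <= 1) (halpha : 0 < alpha <= 1) (m : nat) :
  let sigma := Num.sqrt ell in
  let ella := 1 - alpha + alpha * ell in
  let s := (1 - alpha + alpha * sigma) ^+ 2 in
  let eta := 4 * alpha * (1 - alpha) * sigma / s in
  let xi := 4 * sigma / (1 - sigma) ^+ 2 in
  let f := fun theta : R =>
    modr alpha sigma theta ^+ (2 * m) * sin theta ^+ 2
      / (1 - 2 * sigma * cos theta + sigma ^+ 2) in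
  let g := fun x : R =>
    Num.sqrt (x * (1 - x)) * (1 - eta * x) ^+ m
      / ((1 - sigma) ^+ 2 + 4 * sigma * x) in
  [/\ origin_integrable (ell == 1) pi f /\
      coefR alpha ell m = (1 - ell) * ella ^+ m
        + 2 * ell / pi * origin_integral (ell == 1) pi f,
      origin_integrable (ell == 1) 1 g /\
      coefR alpha ell m = (1 - ell) * ella ^+ m
        + (8 * ell / pi * origin_integral (ell == 1) 1 g) * s ^+ m,
      ell < 1 ->
      coefR alpha ell m = (1 - ell) * ella ^+ m
        + ell / (1 - sigma) ^+ 2
          * appellF1 (3 / 2) (- m%:R) 1 3 eta (- xi) * s ^+ m
    & ell = 1 ->
      coefR alpha ell m = hyp2F1 (1 / 2) (- m%:R) 2 (4 * alpha * (1 - alpha)) ].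
Proof.
move=> sigma ella s eta xi f g.
have /andP[ell0 ell1] := hell; have /andP[al0 al1] := halpha.
have al_neq0 : alpha != 0 by rewrite gt_eqF.
have sgE : sigma ^+ 2 = ell by rewrite sqr_sqrtr// ltW.
have sg01 : 0 < sigma <= 1.
  by rewrite sqrtr_gt0 ell0 /= -[leRHS](@sqrtr1 R) ler_wsqrtr.
have eq1 : (ell == 1) = (sigma == 1).
  have /andP[sg0 _] := sg01.
  have sgN1 : -1 < sigma := lt_trans (ltrN10 R) sg0.
  by rewrite -sgE sqrf_eq1 (gt_eqF sgN1) orbF.
have pi0 : pi != 0 :> R by rewrite gt_eqF// pi_gt0.
have [f1 f2] := @origin_theta _ _ _ m halpha sg01.
have [g1 g2] := @origin_x _ alpha _ m sg01.
have main := coefR_kern sg01 al_neq0 m; rewrite int_sqmod// sgE in main.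
rewrite -/s -/eta in f2 g1 g2 main.
rewrite eq1; split.
- by split=> //; rewrite f2.
- split=> //; rewrite /g -/(wfun sigma eta m) g2 main; congr (_ + _).
  move: (Rintegral _ _ _) => K.
  by move: (@pi R) pi0 => p p0; field.
- move=> ell_lt1; have sg1 : sigma < 1.
    by move: eq1; rewrite lt_eqF// => /esym /(sg_lt1 sg01).
  rewrite appellE// main; congr (_ + _).
  have s10 : 1 - sigma != 0 by rewrite subr_eq0 eq_sym lt_eqF.
  move: (Rintegral _ _ _) => K.
  by move: (@pi R) pi0 => p p0; field; rewrite p0 s10.
- move=> ell_eq1; have sg1 : sigma = 1 by apply/eqP; rewrite -eq1 ell_eq1.
  (* At [sigma = 1] the first summand drops out and [kern] is [1 - hav t], the weight of the moments
     in [hyp2F1_moment]. *)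
  rewrite (hyp2F1_moment m) main ell_eq1 subrr mul0r add0r mulr1.
  have s1 : s = 1 by rewrite /s sg1; ring.
  have -> : eta = 4 * alpha * (1 - alpha) by rewrite /eta s1 sg1 mulr1 divr1.
  rewrite s1 expr1n mul1r; congr (_ * _); apply: eq_Rintegral => t _; congr (_ * _).
  by rewrite /kern sg1 eqxx /hav; field.
Qed.
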